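(* Let $\mathcal{A}$ be a 2-formal essential central arrangement of rank $n$ in $\mathbb{C}^n$ with $|\mathcal{A}|=d$. Let $I_2$ be the ideal generated by the quadratic elements of the Orlik-Terao ideal of $\mathcal{A}$. If $I_2$ is a complete intersection, then $$b_2=\binom{d}{2}-d+n,$$ where $b_2$ is the dimension of the degree-two part of the Orlik-Solomon algebra of $\mathcal{A}$.
   Context: Arrangement: $\mathcal{A}=\{H_1,\dots,H_d\}$ is a set of $d$ distinct hyperplanes through the origin in $\mathbb{C}^n$, $H_i=V(\alpha_i)$ with $\alpha_i\in\mathbb{C}[x_1,\dots,x_n]_1$ nonzero linear forms (fixed once and for all; pairwise non-proportional). $\mathcal{A}$ is essential, i.e. $\bigcap_i H_i=\{0\}$, equivalently $\alpha_1,\dots,\alpha_d$ span an $n$-dimensional space (rank $n$). Orlik-Terao ideal: let $R=\mathbb{C}[y_1,\dots,y_d]$. For each $\Lambda=\{i_1,\dots,i_k\}\subseteq\{1,\dots,d\}$ with $\operatorname{codim}\bigcap_{j}H_{i_j}<k$ and each nontrivial linear dependency $\sum_{j=1}^k c_{i_j}\alpha_{i_j}=0$, put $r_\Lambda=\sum_{j}c_{i_j}y_{i_j}$ and $f_\Lambda=\partial(r_\Lambda)=\sum_{j=1}^k c_{i_j}\,(y_{i_1}\cdots\widehat{y_{i_j}}\cdots y_{i_k})$. The ideal $I\subseteq R$ generated by all the $f_\Lambda$ is the Orlik-Terao ideal of $\mathcal{A}$. $I_2$ denotes the ideal of $R$ generated by the degree-two elements of $I$. It is a complete intersection if $\operatorname{codim}(I_2)$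 equals its minimal number of generators, which is the dimension of the space of quadrics in $I$. 2-formality: the relation space $F(\mathcal{A})$ is the kernel of the linear map $\bigoplus_{i=1}^d\mathbb{C}e_i\to\mathbb{C}[x_1,\dots,x_n]_1$, $e_i\mapsto\alpha_i$. $\mathcal{A}$ is 2-formal if $F(\mathcal{A})$ is spanned by relations involving only three hyperplanes (three nonzero coefficients). Orlik-Solomon algebra: the quotient of the exterior algebra $\bigwedge(\mathbb{C}^d)$ on degree-one generators $e_1,\dots,e_d$ by the ideal generated by all $\sum_q(-1)^{q-1}e_{i_1}\cdots\widehat{e_{i_q}}\cdots e_{i_r}$ with $\operatorname{codim}(H_{i_1}\cap\cdots\cap H_{i_r})<r$; it is isomorphic to $H^*(\mathbb{C}^n\setminus\bigcup_i H_i,\mathbb{C})$, so $b_2$ is the second Betti number of the complement. *)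

(* Defs.v *)
From HB Require Import structures.
From mathcomp Require Import all_boot all_order all_algebra all_field.
From mathcomp Require Import ring mpoly.

Set Implicit Arguments.
Unset Strict Implicit.
Unset Printing Implicit Defensive.

Import GRing.Theory.
Local Open Scope ring_scope.

(* The exterior algebra of K^d: u S is the coefficient of u on
   e_S = e_(i_1) ... e_(i_r), for S = {i_1 < ... < i_r}. *)
Definition exterior (K : fieldType) (d : nat) := {ffun {set 'I_d} -> K^o}.

HB.instance Definition _ (K : fieldType) (d : nat) := Vector.on (exterior K d).

Section Exterior.
Variables (K : fieldType) (d : nat).
Local Notation E := (exterior K d).
Implicit Types (S T U : {set 'I_d}) (u v w : E).

(* For disjoint S and T, e_S e_T = ext_sign S T * e_(S :|: T): the sign counts
   the transpositions that sort the concatenation of S and T. *)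
Definition ext_sign S T : K :=
  (-1) ^+ (\sum_(i in S) \sum_(j in T) (j < i)%N).

Definition ext_basis S : E := [ffun U => (U == S)%:R].

Definition ext_mul u v : E :=
  [ffun U : {set 'I_d} =>
     \sum_(S : {set 'I_d} | S \subset U)
       ext_sign S (U :\: S) * (u S * v (U :\: S))].

Lemma ext_sign0l T : ext_sign set0 T = 1.
Proof. by rewrite /ext_sign big_set0. Qed.

Lemma ext_sign0r S : ext_sign S set0 = 1.
Proof.
by rewrite /ext_sign; under eq_bigr do rewrite big_set0; rewrite big1_eq.
Qed.

Lemma sumn_setU S T (F : 'I_d -> nat) : [disjoint S & T] ->
  (\sum_(i in S :|: T) F i = \sum_(i in S) F i + \sum_(i in T) F i)%N.
Proof.
by move=> dST; rewrite -bigU //=; apply: eq_bigl => i; rewrite !inE.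
Qed.

Lemma ext_signUl S T U : [disjoint S & T] ->
  ext_sign (S :|: T) U = ext_sign S U * ext_sign T U.
Proof. by move=> dST; rewrite /ext_sign -exprD sumn_setU. Qed.

Lemma ext_signUr S T U : [disjoint T & U] ->
  ext_sign S (T :|: U) = ext_sign S T * ext_sign S U.
Proof.
move=> dTU; rewrite /ext_sign -exprD -big_split /=.
by congr (_ ^+ _); apply: eq_bigr => i _; rewrite sumn_setU.
Qed.

Lemma ext_mulA : associative ext_mul.
Proof.
move=> u v w; apply/ffunP => U; rewrite !ffunE.
under eq_bigr do rewrite ffunE.
under [RHS]eq_bigr do rewrite ffunE.
under [RHS]eq_bigr do rewrite big_distrl /= big_distrr /=.
under [LHS]eq_bigr do rewrite !big_distrr /=.
rewrite [RHS](exchange_big_dep (fun S : {set 'I_d} => S \subset U)) /=;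
  last by move=> B S sBU /subset_trans; apply.
apply: eq_bigr => S sSU.
rewrite [RHS](reindex_onto (fun T => S :|: T) (fun B => B :\: S)) /=; last first.
  move=> B /andP[_ sSB]; apply/setP=> x; rewrite !inE.
  by case: (boolP (x \in S)) => //= /(subsetP sSB).
apply: eq_big => [T|T]; rewrite subsetD.
  rewrite subUset sSU subsetUl /= andbT setDUl setDv set0U.
  by congr andb; apply/idP/eqP => /setDidPl.
case/andP=> sTU dTS.
have -> : (S :|: T) :\: S = T by rewrite setDUl setDv set0U; apply/setDidPl.
rewrite -setDDl; set V := U :\: S :\: T.
have dTV : [disjoint T & V].
  by rewrite disjoint_sym disjoints_subset; apply/subsetP => x /setDP[_ xT]; rewrite inE.
have -> : U :\: S = T :|: V.
  have sTUS : T \subset U :\: S by rewrite subsetD sTU.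
  by rewrite /V -{1}(setID (U :\: S) T) (setIidPr sTUS).
rewrite ext_signUr // ext_signUl 1?disjoint_sym //.
by ring.
Qed.

Lemma ext_mul1 : left_id (ext_basis set0) ext_mul.
Proof.
move=> u; apply/ffunP => U; rewrite ffunE (bigD1 set0) ?sub0set //= big1.
  by rewrite addr0 ffunE eqxx setD0 ext_sign0l !mul1r.
by move=> S /andP[_ /negPf nS]; rewrite ffunE nS mul0r mulr0.
Qed.

Lemma ext_mulr1 : right_id (ext_basis set0) ext_mul.
Proof.
move=> u; apply/ffunP => U; rewrite ffunE (bigD1 U) //= big1.
  by rewrite addr0 ffunE setDv eqxx ext_sign0r mulr1 mul1r.
move=> S /andP[sSU nS]; rewrite ffunE; case: eqP => [/eqP|_]; last by rewrite !mulr0.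
by rewrite setD_eq0 => sUS; rewrite eqEsubset sSU sUS in nS.
Qed.

Lemma ext_mulDl : left_distributive ext_mul +%R.
Proof.
move=> u v w; apply/ffunP => U; rewrite !ffunE -big_split /=.
by apply: eq_bigr => S _; rewrite ffunE mulrDl mulrDr.
Qed.

Lemma ext_mulDr : right_distributive ext_mul +%R.
Proof.
move=> u v w; apply/ffunP => U; rewrite !ffunE -big_split /=.
by apply: eq_bigr => S _; rewrite ffunE !mulrDr.
Qed.

Lemma ext_basis0_neq0 : ext_basis set0 != 0.
Proof.
by apply/eqP => /ffunP/(_ set0)/eqP; rewrite !ffunE eqxx oner_eq0.
Qed.

HB.instance Definition _ := GRing.Zmodule_isNzRing.Build (exterior K d)
  ext_mulA ext_mul1 ext_mulr1 ext_mulDl ext_mulDr ext_basis0_neq0.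

Lemma ext_scaleAl (a : K) u v : a *: (u * v) = a *: u * v.
Proof.
apply/ffunP => U; rewrite !ffunE scaler_sumr.
by apply: eq_bigr => S _; rewrite ffunE /GRing.scale /=; ring.
Qed.

HB.instance Definition _ :=
  GRing.Lmodule_isLalgebra.Build K (exterior K d) ext_scaleAl.

Lemma ext_scaleAr (a : K) u v : a *: (u * v) = u * (a *: v).
Proof.
apply/ffunP => U; rewrite !ffunE scaler_sumr.
by apply: eq_bigr => S _; rewrite ffunE /GRing.scale /=; ring.
Qed.

HB.instance Definition _ :=
  GRing.Lalgebra_isAlgebra.Build K (exterior K d) ext_scaleAr.

HB.instance Definition _ := Algebra_isFalgebra.Build K (exterior K d).

Definition ext_gen (i : 'I_d) : E := ext_basis [set i].

Lemma ext_basisM S T : ext_basis S * ext_basis T =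
  if [disjoint S & T] then ext_sign S T *: ext_basis (S :|: T) else 0.
Proof.
apply/ffunP => U; rewrite ffunE.
transitivity (((S \subset U) && (U :\: S == T))%:R * ext_sign S T).
  case: (boolP (S \subset U)) => [sSU|nSU]; last first.
    rewrite mul0r big1 // => S' sS'U; rewrite !ffunE.
    by case: eqP nSU => [<-|_ _]; rewrite ?sS'U // mul0r mulr0.
  rewrite (bigD1 S) //= big1 ?addr0 => [|S' /andP[_ /negPf nS]]; last first.
    by rewrite !ffunE nS mul0r mulr0.
  by rewrite !ffunE eqxx mul1r; case: eqP => [->|_]; rewrite ?(mulr1, mul1r, mulr0, mul0r).
have -> : (S \subset U) && (U :\: S == T) = [disjoint S & T] && (U == S :|: T).
  apply/andP/andP => [[sSU /eqP <-]|[dST /eqP ->]]; split.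
  - by rewrite disjoint_sym disjoints_subset; apply/subsetP => x /setDP[_ xS]; rewrite inE.
  - by rewrite -{1}(setID U S) (setIidPr sSU).
  - exact: subsetUl.
  - by rewrite setDUl setDv set0U; apply/eqP/setDidPl; rewrite disjoint_sym.
case: ifP => _; rewrite ?ffunE /= ?mul0r //.
by rewrite /GRing.scale /= mulrC.
Qed.

Lemma ext_gen_sq i : ext_gen i * ext_gen i = 0.
Proof. by rewrite ext_basisM disjoints1 inE eqxx. Qed.

Lemma ext_gen_anticomm i j : ext_gen i * ext_gen j = - (ext_gen j * ext_gen i).
Proof.
have [->|nij] := eqVneq i j; first by rewrite ext_gen_sq oppr0.
rewrite !ext_basisM !disjoints1 !inE [j == i]eq_sym nij /= setUC -scaleNr.
rewrite /ext_sign !big_set1; congr (_ *: _).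
by case: ltngtP nij => [_ _|_ _|/val_inj->]; rewrite ?eqxx ?opprK.
Qed.

(* The monomials e_(i_1) ... e_(i_r) with i_1 < ... < i_r form a basis. *)
Lemma ext_basisE S : ext_basis S = \prod_(i <- enum S) ext_gen i.
Proof.
have: sorted (fun i j : 'I_d => i < j)%N (enum S).
  rewrite /enum_mem; apply: sorted_filter => [i j k|]; first exact: ltn_trans.
  by rewrite -enumT -[sorted _ _](@sorted_map _ _ val ltn) val_enum_ord iota_ltn_sorted.
have: S = [set i in enum S] by apply/setP => i; rewrite inE mem_enum.
move: (enum S) => s; elim: s S => [|i s IHs] S eS; first by rewrite eS big_nil.
rewrite /= path_sortedE => [/andP[/allP ltis ss]|? ? ?]; last exact: ltn_trans.
rewrite big_cons -(IHs _ erefl ss) ext_basisM.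
have nis : i \notin [set j in s].
  by rewrite inE; apply/negP => /ltis; rewrite ltnn.
rewrite disjoints1 nis /ext_sign big_set1 big1 => [|j]; last first.
  by rewrite inE => /ltis ltij; rewrite ltnNge ltnW.
by rewrite expr0 scale1r eS set_cons.
Qed.

Definition ext_deg (k : nat) : {vspace E} :=
  (<<[seq ext_gen i | i : 'I_d]>> ^+ k)%VS.

End Exterior.

From mathcomp Require Import classical_sets.
Local Open Scope classical_set_scope.

Section Ideals.
Variable A : comNzRingType.
Implicit Types (S J P : set A) (k m : nat).

Definition ideal_gen S : set A :=
  [set p | exists m (a g : 'I_m -> A),
     (forall i, S (g i)) /\ p = \sum_(i < m) a i * g i].

(* [idealr_closed] includes properness. *)
Definition is_prime_ideal P : Prop :=
  idealr_closed (mem P) /\ prime_idealr_closed (mem P).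

(* Q 0 < Q 1 < ... < Q k = P, a chain of length k of prime ideals *)
Definition prime_chain_to P k (Q : nat -> set A) : Prop :=
  [/\ forall i, (i <= k)%N -> is_prime_ideal (Q i),
      forall i, (i < k)%N -> Q i `<` Q i.+1
    & Q k = P].

Definition height_ge P k : Prop := exists Q, prime_chain_to P k Q.

Definition has_height P k : Prop := height_ge P k /\ ~ height_ge P k.+1.

(* The codimension (height) of an ideal is the least height of a prime ideal
   containing it; the unit ideal has no codimension. *)
Definition has_codim J k : Prop :=
  (exists P, [/\ is_prime_ideal P, J `<=` P & has_height P k]) /\
  (forall P, is_prime_ideal P -> J `<=` P -> height_ge P k).

Definition generated_by_n J m : Prop :=
  exists g : 'I_m -> A, J = ideal_gen (range g).

Definition min_num_gens J m : Prop :=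
  generated_by_n J m /\ forall m', generated_by_n J m' -> (m <= m')%N.

Definition complete_intersection J : Prop :=
  exists m, has_codim J m /\ min_num_gens J m.

End Ideals.

(* alpha : 'M_(d, n) encodes d linear forms on K^n, row i being the coefficients
   of the i-th one; vectors of K^n and of K^d are rows. *)
Section Arrangement.
Variables (K : fieldType) (d n : nat) (alpha : 'M[K]_(d, n)).
Implicit Types S : {set 'I_d}.

(* The row space is {x | alpha_i(x) = 0}. *)
Definition hyperplane (i : 'I_d) : 'M[K]_n := kermx (row i alpha)^T.

Definition central_arrangement : Prop :=
  (forall i, row i alpha != 0) /\
  (forall i j, (hyperplane i == hyperplane j)%MS -> i = j).

Definition flat S : 'M[K]_n := (\bigcap_(i in S) hyperplane i)%MS.

Definition codim_flat S : nat := (n - \rank (flat S))%N.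

Definition essential : Prop := (\bigcap_(i < d) hyperplane i)%MS = 0.

Definition relation_space : 'M[K]_d := kermx alpha.

Definition two_formal : Prop :=
  exists m (B : 'M[K]_(m, d)),
    (B == relation_space)%MS /\
    (forall i, #|[pred j | B i j != 0]| = 3%N).

Definition ot_generator S (c : 'I_d -> K) : {mpoly K[d]} :=
  \sum_(j in S) c j *: \prod_(i in S | i != j) 'X_i.

Definition ot_ideal : set {mpoly K[d]} :=
  ideal_gen [set f | exists S (c : 'I_d -> K),
    [/\ (codim_flat S < #|S|)%N,
        (exists2 j, j \in S & c j != 0),
        \sum_(j in S) c j *: row j alpha = 0
      & f = ot_generator S c]].

Definition ot_quadratic_ideal : set {mpoly K[d]} :=
  ideal_gen [set f | ot_ideal f /\ f \is 2.-homog].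

(* Positions are counted from 0, so the sign (-1)^(q-1) becomes (-1)^q. *)
Definition os_boundary (s : seq 'I_d) : exterior K d :=
  \sum_(q < size s)
    (-1) ^+ q *: \prod_(i <- take q s ++ drop q.+1 s) ext_gen K i.

(* The two-sided ideal; [enum S] lists S in increasing order. *)
Definition os_ideal : {vspace exterior K d} :=
  ({:exterior K d} *
   (\sum_(S : {set 'I_d} | (codim_flat S < #|S|)%N) <[os_boundary (enum S)]>) *
   {:exterior K d})%VS.

(* The degree-k part of the Orlik-Solomon algebra is the image of
   [ext_deg K d k] in the quotient by [os_ideal]. *)
Definition os_betti (k : nat) : nat :=
  (\dim (ext_deg K d k) - \dim (ext_deg K d k :&: os_ideal)%VS)%N.

End Arrangement.

(* Main.v *)
From HB Require Import structures.
Require Import Defs.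
From mathcomp Require Import boolp classical_sets.
From mathcomp Require Import all_boot all_order all_algebra all_field.
From mathcomp Require Import reals complex mpoly ring zify.

Set Implicit Arguments.
Unset Strict Implicit.
Unset Printing Implicit Defensive.

Import Order.TTheory GRing.Theory Num.Theory.
Local Open Scope ring_scope.

(** In degree two, the Orlik-Solomon ideal is spanned by the boundaries of the
    products e_i e_j e_k over the dependent triples i < j < k
    ([os_ideal_deg2]).  Let q be the dimension of this span W.  The second
    Betti number is binomial(d, 2) - q, so the claim is q = d - n.  Write J for
    the ideal generated by the quadrics of the Orlik-Terao ideal, and let m be
    the number with codim J = m such that J is generated by m elements.  Then
    d - n <= q <= m <= d - n.

    The first two inequalities rest on two generic vectors v and v'.  Put
    a_i = alpha_i(v), b_i = alpha_i(v') and w_ij = a_i b_j - a_j b_i; no a_i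
    vanishes, and w_ij vanishes only for i = j.  The relation carried by a
    dependent triple i < j < k has to annihilate (a_i, a_j, a_k) and
    (b_i, b_j, b_k), so it is proportional to their cross product
    (w_jk, -w_ik, w_ij) ([triple_scaled]).

    - q <= m ([triple_relations_dim_le]): rescaling e_i e_j to w_ij y_i y_j
      turns the boundary of a dependent triple into a scalar multiple of the
      corresponding quadric of the Orlik-Terao ideal.  Hence W embeds in the
      space of quadratic forms of J.  As J has no element with a term of degree
      below two, that space is spanned by the quadratic parts of any
      generators of J.

    - d - n <= q ([le_dim_triple_relations]): the gradient of the quadric of a
      dependent triple, at the point (1/a_i) of its zero locus, is up to a
      scalar and a diagonal rescaling the relation that the quadric comes from.
      So W maps onto the span of the relations of length three, which by
      2-formality is the whole relation space, of dimension at least d - n.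

    - m <= d - n ([orlik_terao_codim_le]): the Orlik-Terao ideal vanishes
      under y_i |-> 1/alpha_i, so J lies in the kernel P of this map to
      the rational functions, and P has height at least m.  The image contains
      n algebraically independent elements.  A chain of m + 1 primes ending in
      P together with these elements would produce m + n elements of the
      polynomial ring in d variables that are algebraically independent, in a
      sense made precise by [chain_peel]; hence m + n <= d
      ([height_add_trdeg_le]). *)

(** * Algebraic dependence in polynomial rings *)

Section AlgebraicDependence.
Variables (K : fieldType) (d : nat).

Lemma msizeM_leS (p q : {mpoly K[d]}) a b :
  (msize p <= a.+1 -> msize q <= b.+1 -> msize (p * q) <= (a + b).+1)%N.
Proof.
move=> pa qb; have [->|p0] := eqVneq p 0; first by rewrite mul0r msize0.
have [->|q0] := eqVneq q 0; first by rewrite mulr0 msize0.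
by rewrite msizeM //; move: pa qb; move: (msize p) (msize q) => u v; lia.
Qed.

Lemma msize_monomial_le N t D (x : 'I_N -> {mpoly K[d]}) (e : 'I_N -> nat) :
  (forall i, msize (x i) <= D.+1)%N -> (forall i, e i <= t)%N ->
  (msize (\prod_i x i ^+ e i) <= (N * (t * D)).+1)%N.
Proof.
move=> xD et.
have pow k (p : {mpoly K[d]}) : (msize p <= D.+1 -> msize (p ^+ k) <= (k * D).+1)%N.
  move=> pD; elim: k => [|k IHk]; first by rewrite expr0 msize1.
  by rewrite exprS mulSn; apply: msizeM_leS.
rewrite -[N in (N * _)%N]card_ord -sum_nat_const.
elim/big_ind2: _ => [|p a q b|i _]; first by rewrite msize1.
  exact: msizeM_leS.
by apply: leq_trans (pow _ _ (xD i)) _; rewrite ltnS leq_mul2r et orbT.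
Qed.

(** Count: the t^N monomials in x_1, ..., x_N with all exponents below t are
    polynomials of degree O(t), hence lie in a space of dimension O(t^d), and
    t^N outgrows this when d < N. *)
Lemma mpoly_algdep N (x : 'I_N -> {mpoly K[d]}) : (d < N)%N ->
  exists t (u : {ffun 'I_N -> 'I_t} -> K),
    (exists e, u e != 0) /\ \sum_e u e *: \prod_i x i ^+ e i = 0.
Proof.
move=> ltdN.
pose D := (\max_i msize (x i))%N.
have xD i : (msize (x i) <= D.+1)%N.
  by apply: leqW; rewrite /D (leq_bigmax i).
(* With this t, (N * t * D + 1)^d <= ((N * D + 1) * t)^d < t^(d + 1). *)
pose t := ((N * D).+1 ^ d).+1.
pose c := (N * (t * D))%N.
pose I := {ffun 'I_N -> 'I_t}; pose C := {ffun 'I_d -> 'I_c.+1}.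
pose mon (e : I) := \prod_i x i ^+ e i.
pose M : 'M[K]_(#|{: I}|, #|{: C}|) :=
  \matrix_(i, j) (mon (enum_val i))@_[multinom ((enum_val j : C) k : nat) | k < d].
have ltCI : (#|{: C}| < #|{: I}|)%N.
  rewrite !card_ffun !card_ord.
  apply: (@leq_trans (t ^ d.+1)); last by rewrite leq_exp2l // /t ltnS expn_gt0.
  have: (c.+1 ^ d <= ((N * D).+1 * t) ^ d)%N.
    by case: (d) => [|d'] //; rewrite leq_exp2r // /c; nia.
  rewrite expnMn expnS => /leq_ltn_trans; apply.
  by rewrite ltn_pmul2r ?expn_gt0.
have : kermx M != 0.
  rewrite kermx_eq0 /row_free neq_ltn; apply/orP; left.
  exact: leq_ltn_trans (rank_leq_col M) ltCI.
case/rowV0Pn => v /sub_kermxP vM v0.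
exists t, (fun e => v 0 (enum_rank e)); split.
  case/rV0Pn: v0 => i vi; exists (enum_val i); by rewrite enum_valK.
apply/mpolyP => m; rewrite mcoeff0 raddf_sum /=.
have [lem|gtm] := leqP (mdeg m) c; last first.
  rewrite big1 // => e _; rewrite mcoeffZ memN_msupp_eq0 ?mulr0 //.
  apply: msize_mdeg_ge; apply: leq_trans gtm.
  by apply: msize_monomial_le => // i; apply: ltnW.
pose jm : C := [ffun k => inord (m k)].
have jmE : [multinom (jm k : nat) | k < d] = m.
  apply/mnmP => k; rewrite mnmE ffunE inordK // ltnS; apply: leq_trans lem.
  by rewrite mdegE (bigD1 k) //= leq_addr.
transitivity ((v *m M) 0 (enum_rank jm)); last by rewrite vM mxE.
rewrite mxE [RHS](reindex (@enum_rank I)) /=; last first.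
  by apply: onW_bij; apply: enum_rank_bij.
apply: eq_bigr => e _; rewrite mcoeffZ mxE !enum_rankK; congr (_ * _).
by rewrite jmE.
Qed.

End AlgebraicDependence.

(** * Heights of prime ideals in polynomial rings *)

Local Open Scope classical_set_scope.

Section Peeling.
Variable A : comNzRingType.
Implicit Types (P : set A).

Lemma prime_ideal0 P : is_prime_ideal P -> P 0.
Proof. by case=> [[+ _ _] _]; rewrite in_setE. Qed.

Lemma prime_idealD P a b : is_prime_ideal P -> P a -> P b -> P (a + b).
Proof.
case=> [[_ _ h] _] Pa Pb; have := h 1 a b; rewrite !in_setE mul1r; exact.
Qed.

Lemma prime_idealMl P a b : is_prime_ideal P -> P b -> P (a * b).
Proof.
move=> prP Pb; case: (prP) => [[_ _ h] _].
have := h a b 0; rewrite !in_setE addr0; apply=> //; exact: prime_ideal0.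
Qed.

Lemma prime_idealX P a k b : is_prime_ideal P -> ~ P a -> P (a ^+ k * b) -> P b.
Proof.
move=> prP nPa; elim: k b => [|k IHk] b; first by rewrite mul1r.
rewrite exprS -mulrA; case: (prP) => _ /(_ a (a ^+ k * b)).
by rewrite !in_setE => h /h /orP[]; rewrite in_setE => // /IHk.
Qed.

Lemma prime_ideal_sum P (I : finType) (S : {pred I}) (F : I -> A) :
  is_prime_ideal P -> (forall i, i \in S -> P (F i)) -> P (\sum_(i in S) F i).
Proof.
move=> prP; apply: big_ind => [|a b]; first exact: prime_ideal0.
exact: prime_idealD.
Qed.

(** The engine of the bound on Krull dimension by algebraic dependence.  Given
    x_i in Q_(i+1) but not in Q_i and a sum of terms u_e x^e in Q_0, divide by
    the lowest power of x_0 that occurs: the quotient is still in Q_0, as this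
    ideal is prime, and modulo Q_1 only the terms that attained the lowest
    power survive.  So the exponent of x_0 is constant on the surviving terms,
    and iterating over the chain strips the variables one by one. *)
Lemma chain_peel (I : finType) (N k : nat) (Q : nat -> set A) (x : nat -> A)
    (u : I -> A) (E : I -> nat -> nat) (S : {set I}) :
  (k <= N)%N ->
  (forall i, (i <= k)%N -> is_prime_ideal (Q i)) ->
  (forall i, (i < k)%N -> [/\ Q i `<=` Q i.+1, ~ Q i (x i) & Q i.+1 (x i)]) ->
  S != set0 ->
  Q 0%N (\sum_(e in S) u e * \prod_(0 <= i < N) x i ^+ E e i) ->
  exists S' : {set I},
    [/\ S' \subset S, S' != set0,
      forall i, (i < k)%N -> {in S' &, forall e e', E e i = E e' i}
    & Q k (\sum_(e in S') u e * \prod_(k <= i < N) x i ^+ E e i)].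
Proof.
elim: k => [|k IHk] kN Qp Qx S0 QS; first by exists S; split.
have [||S1 [sS1 S10 S1c QS1]] := IHk (ltnW kN) _ _ S0 QS.
- by move=> i ik; apply/Qp/leqW.
- by move=> i ik; apply/Qx/leqW.
case/set0Pn: (S10) => e0 e0S1.
pose em := [arg min_(e < e0 in S1) E e k].
have [emS1 emin] : em \in S1 /\ forall e, e \in S1 -> (E em k <= E e k)%N.
  by rewrite /em; case: arg_minnP => // e eS1 h; split.
have [Qkk nQx Qx'] := Qx k (ltnSn k).
have prk : is_prime_ideal (Q k) by apply: Qp.
have prk1 : is_prime_ideal (Q k.+1) by apply: Qp.
pose f e := u e * (x k ^+ (E e k - E em k) * \prod_(k.+1 <= i < N) x i ^+ E e i).
(* Dividing by the lowest power of x_k. *)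
have Qf : Q k.+1 (\sum_(e in S1) f e).
  apply/Qkk/(@prime_idealX _ (x k) (E em k)) => //.
  rewrite mulr_sumr; congr (Q k _): QS1; apply: eq_bigr => e eS1.
  by rewrite big_ltn // /f -{1}(subnKC (emin e eS1)) exprD; ring.
exists [set e in S1 | E e k == E em k]; split.
- by apply: subset_trans sS1; apply/subsetP => e; rewrite inE => /andP[].
- by apply/set0Pn; exists em; rewrite inE emS1 eqxx.
- move=> i; rewrite ltnS leq_eqVlt => /predU1P[->|ik] e e'; rewrite !inE.
    by move=> /andP[_ /eqP->] /andP[_ /eqP->].
  by move=> /andP[eS _] /andP[eS' _]; apply: S1c.
have -> : \sum_(e in [set e in S1 | E e k == E em k])
    u e * \prod_(k.+1 <= i < N) x i ^+ E e i =
  \sum_(e in S1) f e + -1 * \sum_(e in [set e in S1 | E e k != E em k]) f e.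
  rewrite [X in _ = X + _](bigID (fun e => E e k == E em k)) /= mulN1r.
  rewrite [X in _ + X - _](_ : _ = \sum_(e in [set e in S1 | E e k != E em k]) f e);
    last by apply: eq_bigl => e; rewrite inE.
  rewrite addrK; apply: eq_big => [e|e]; rewrite inE //.
  by case/andP=> _ /eqP eq; rewrite /f eq subnn mul1r.
apply: prime_idealD => //; apply: prime_idealMl => //; apply: prime_ideal_sum => // e.
rewrite inE => /andP[eS1 ne]; apply: prime_idealMl => //; rewrite mulrC.
apply: prime_idealMl => //.
have : (0 < E e k - E em k)%N by rewrite subn_gt0 ltn_neqAle eq_sym ne emin.
by case: (_ - _)%N => // j _; rewrite exprSr; apply: prime_idealMl.
Qed.

End Peeling.

(** An element of Q_(i+1) outside Q_i for each step of the chain, followed by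
    z, are k + n elements; a dependence between them would leave, after
    [chain_peel], a nonzero polynomial in z that belongs to P. *)
Lemma height_add_trdeg_le (K : fieldType) (d k n : nat) (P : set {mpoly K[d]})
    (z : n.-tuple {mpoly K[d]}) :
  height_ge P k ->
  (forall F : {mpoly K[n]}, P (F \mPo z) -> F = 0) -> (k + n <= d)%N.
Proof.
case=> Q [Qp Qlt Qk] zfree; rewrite leqNgt; apply/negP => ltdN.
have Qx i : exists a, (i < k)%N -> ~ Q i a /\ Q i.+1 a.
  have [ik|_] := ltnP i k; last by exists 0.
  have [sQ nsQ] := Qlt i ik.
  have [a] : exists a, ~ (Q i.+1 a -> Q i a).
    by apply/existsNP => h; apply: nsQ => a; apply: h.
  by move/not_implyP => [Qa nQa]; exists a.
pose y i := projT1 (cid (Qx i)).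
have yP i : (i < k)%N -> ~ Q i (y i) /\ Q i.+1 (y i).
  exact: (projT2 (cid (Qx i))).
pose x i := if (i < k)%N then y i else nth 0 z (i - k).
have [t [u [[e1 ue1] ux]]] := @mpoly_algdep K d (k + n) (fun i => x i) ltdN.
(* Exponents have to be indexed by nat for the peeling; outside the range of
   the variables they are set to 0. *)
pose E (e : {ffun 'I_(k + n) -> 'I_t}) i : nat :=
  if insub i is Some j then e j else 0%N.
have EE e (j : 'I_(k + n)) : E e j = e j by rewrite /E valK.
have [|||S [sS S0 Sc]] := @chain_peel _ _ (k + n) k Q x (fun e => (u e)%:MP) E
  [set e | u e != 0] (leq_addr _ _) Qp.
- move=> i ik; rewrite /x ik; have [? ?] := yP i ik; split=> //.
  by case: (Qlt i ik).
- by apply/set0Pn; exists e1; rewrite inE.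
- have := prime_ideal0 (Qp 0%N (leq0n _)); rewrite -{1}ux.
  congr (Q _ _); rewrite [RHS]big_mkcond /=; apply: eq_bigr => e _.
  rewrite inE mul_mpolyC big_mkord; case: ifPn => [_|].
    by congr (_ *: _); apply: eq_bigr => j _; rewrite EE.
  by rewrite negbK => /eqP->; rewrite scale0r.
rewrite Qk => PS.
(* The exponents of the surviving terms agree in the first k places, so they
   are told apart by the last n and no two terms of F cancel. *)
pose F : {mpoly K[n]} := \sum_(e in S) u e *: 'X_[[multinom E e (k + j)%N | j < n]].
have F0 : F = 0.
  apply: zfree; congr (P _): PS; rewrite /F raddf_sum /=; apply: eq_bigr => e _.
  rewrite comp_mpolyZ mul_mpolyC comp_mpolyX; congr (_ *: _).
  rewrite -[X in index_iota X _]add0n big_addn addKn big_mkord; apply: eq_bigr => j _.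
  by rewrite mnmE /x ltnNge leq_addl /= addnK addnC (tnth_nth 0).
case/set0Pn: S0 => e0 e0S.
have := congr1 (mcoeff [multinom E e0 (k + j)%N | j < n]) F0.
rewrite mcoeff0 /F raddf_sum /= (bigD1 e0) //= big1 ?addr0 => [|e /andP[eS ne]].
  rewrite mcoeffZ mcoeffX eqxx mulr1 => u0.
  by have := subsetP sS _ e0S; rewrite inE u0 eqxx.
rewrite mcoeffZ mcoeffX; case: eqP => [eqE|]; last by rewrite mulr0.
case/eqP: ne; apply/ffunP => i; apply: val_inj; rewrite /= -!EE.
have [ik|ki] := ltnP i k; first exact: Sc.
have lt_in : (i - k < n)%N by rewrite ltn_subLR.
move/mnmP/(_ (Ordinal lt_in)): eqE; by rewrite !mnmE /= subnKC.
Qed.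

Lemma ideal_gen_mem (A : comNzRingType) (G : set A) f : G f -> ideal_gen G f.
Proof.
by move=> Gf; exists 1%N, (fun=> 1), (fun=> f); split=> //; rewrite big_ord1 mul1r.
Qed.

Lemma ideal_gen_prime (A : comNzRingType) (G P : set A) :
  is_prime_ideal P -> G `<=` P -> ideal_gen G `<=` P.
Proof.
move=> prP sGP _ [m [a [g [Gg ->]]]]; apply: (@prime_ideal_sum _ _ _ predT) => // i _.
by apply: prime_idealMl => //; apply: sGP.
Qed.

Lemma ker_prime_ideal (A : comNzRingType) (B : idomainType) (f : {rmorphism A -> B}) :
  is_prime_ideal [set p | f p = 0].
Proof.
split; first split.
- by rewrite in_setE /= rmorph0.
- by apply/negP; rewrite in_setE /= rmorph1; apply/eqP/oner_neq0.
- by move=> a u v; rewrite !in_setE /= rmorphD rmorphM => -> ->; rewrite mulr0 addr0.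
move=> u v; rewrite !in_setE /= rmorphM => /eqP; rewrite mulf_eq0.
by case/orP=> /eqP h; apply/orP; [left|right]; rewrite in_setE.
Qed.

(** * The codimension of the quadratic Orlik-Terao ideal *)

Section Reciprocals.
Variables (K : fieldType) (d n : nat).

Definition linform (r : 'rV[K]_n) : {mpoly K[n]} := \sum_k r 0 k *: 'X_k.

Lemma mcoeff_linform r k : (linform r)@_U_(k) = r 0 k.
Proof.
rewrite raddf_sum (bigD1 k) //= mcoeffZ mcoeffXU eqxx mulr1.
by rewrite big1 ?addr0 // => i /negPf ik; rewrite mcoeffZ mcoeffXU ik mulr0.
Qed.

Lemma linform_eq0 r : (linform r == 0) = (r == 0).
Proof.
apply/eqP/eqP => [r0|->]; last by rewrite /linform big1 // => k _; rewrite mxE scale0r.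
by apply/rowP => k; rewrite -mcoeff_linform r0 mcoeff0 mxE.
Qed.

Lemma linform_delta k : linform (delta_mx 0 k) = 'X_k.
Proof.
rewrite /linform (bigD1 k) //= mxE !eqxx scale1r big1 ?addr0 // => i /negPf ik.
by rewrite mxE eqxx ik scale0r.
Qed.

Lemma linform_is_linear : linear linform.
Proof.
move=> c r s; rewrite /linform scaler_sumr -big_split; apply: eq_bigr => k _.
by rewrite !mxE scalerDl scalerA.
Qed.
HB.instance Definition _ := GRing.isLinear.Build K _ _ _ linform linform_is_linear.

Definition constF : {rmorphism K -> {fraction {mpoly K[n]}}} :=
  @FracField.tofrac _ \o @mpolyC n K.

(** The kernel of this map, when the rows of l are the forms of an arrangement,
    is the prime ideal that the Orlik-Terao ideal is contained in. *)
Definition reciprocal_map (l : 'M[K]_(d, n)) :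
    {rmorphism {mpoly K[d]} -> {fraction {mpoly K[n]}}} :=
  mmap constF (fun i => (FracField.tofrac (linform (row i l)))^-1).

(** Under y_i |-> 1/l_i the generator f_S becomes
    (prod_S 1/l_i) * (sum_S c_j l_j). *)
Lemma reciprocal_ot_generator l (S : {set 'I_d}) (c : 'I_d -> K) :
  (forall i, row i l != 0) -> \sum_(j in S) c j *: row j l = 0 ->
  reciprocal_map l (ot_generator S c) = 0.
Proof.
move=> l0 cl0; rewrite /ot_generator raddf_sum /=.
pose p i : {fraction {mpoly K[n]}} := FracField.tofrac (linform (row i l)).
have p0 i : p i != 0 by rewrite tofrac_eq0 linform_eq0.
transitivity ((\prod_(i in S) (p i)^-1) * \sum_(j in S) constF (c j) * p j).
  rewrite mulr_sumr; apply: eq_bigr => j jS.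
  rewrite mmapZ rmorph_prod /= mulrCA; congr (_ * _).
  under eq_bigr do rewrite mmapX mmap1U.
  by rewrite [in RHS](bigD1 j) //= mulrAC mulVf ?mul1r.
suff -> : \sum_(j in S) constF (c j) * p j = 0 by rewrite mulr0.
transitivity (FracField.tofrac (linform (\sum_(j in S) c j *: row j l))).
  rewrite linear_sum rmorph_sum /=; apply: eq_bigr => j _.
  by rewrite linearZ /= -mul_mpolyC rmorphM.
by rewrite cl0 !raddf0.
Qed.

(** Clearing denominators with the T-th power of every variable turns
    F(1/X) into a polynomial with the same coefficients as F, in which the
    exponents m are replaced by T - m. *)
Lemma inverse_vars_free (F : {mpoly K[n]}) :
  mmap constF (fun k => (FracField.tofrac ('X_k : {mpoly K[n]}))^-1) F = 0 -> F = 0.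
Proof.
move=> F0; pose T := msize F.
pose V k : {fraction {mpoly K[n]}} := FracField.tofrac 'X_k.
have V0 k : V k != 0.
  rewrite tofrac_eq0; apply/eqP => /(congr1 (mcoeff U_(k))).
  by rewrite mcoeffXU eqxx mcoeff0 => /eqP; rewrite oner_eq0.
have leT (m : 'X_{1..n}) k : m \in msupp F -> (m k <= T)%N.
  move/msize_mdeg_lt/ltnW; apply: leq_trans.
  by rewrite mdegE (bigD1 k) //= leq_addr.
pose G : {mpoly K[n]} := \sum_(m <- msupp F) F@_m *: 'X_[[multinom (T - m k)%N | k < n]].
have G0 : G = 0.
  apply/eqP; rewrite -tofrac_eq0; apply/eqP.
  transitivity (\prod_k V k ^+ T * mmap constF (fun k => (V k)^-1) F);
    last by rewrite F0 mulr0.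
  rewrite /mmap mulr_sumr raddf_sum /=; apply: eq_big_seq => m mF.
  rewrite -mul_mpolyC rmorphM /= [RHS]mulrCA; congr (_ * _).
  rewrite mpolyXE_id rmorph_prod /mmap1 -big_split /=; apply: eq_bigr => k _.
  by rewrite mnmE rmorphXn /= exprVn -expfB_cond ?(leT m k) // (negPf (V0 k)) add0n leT.
apply/mpolyP => m0; rewrite mcoeff0; apply/eqP; rewrite mcoeff_eq0; apply/negP => m0F.
have := congr1 (mcoeff [multinom (T - m0 k)%N | k < n]) G0.
rewrite mcoeff0 /G raddf_sum /= (bigD1_seq m0) ?msupp_uniq //= big_seq_cond big1.
  rewrite addr0 mcoeffZ mcoeffX eqxx mulr1 => /eqP.
  by rewrite mcoeff_eq0 m0F.
move=> m /andP[mF ne]; rewrite mcoeffZ mcoeffX; case: eqP => [e|]; last by rewrite mulr0.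
case/eqP: ne; apply/mnmP => k; move/mnmP/(_ k): e; rewrite !mnmE.
by have := leT m k mF; have := leT m0 k m0F; lia.
Qed.

(** A linear change of coordinates turns n of the forms into the coordinate
    functions; the corresponding variables are algebraically independent modulo
    the kernel of y_i |-> 1/l_i because they are sent to 1/X_1, ..., 1/X_n. *)
Lemma orlik_terao_codim_le (alpha : 'M[K]_(d, n)) k :
  (forall i, row i alpha != 0) -> row_full alpha ->
  has_codim (ot_quadratic_ideal alpha) k -> (k + n <= d)%N.
Proof.
move=> a0 full [_ codim].
pose f := fullrankfun full.
pose B := rowsub f alpha.
have Bu : B \in unitmx := fullrowsub_unit full.
pose l := alpha *m invmx B.
have rowlE i : row i l = row i alpha *m invmx B by rewrite row_mul.
have l0 i : row i l != 0.
  apply/eqP => /(congr1 (mulmx^~ B)); rewrite rowlE mulmxKV // mul0mx.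
  exact/eqP/a0.
have lf k0 : row (f k0) l = delta_mx 0 k0.
  rewrite rowlE -[row _ alpha](_ : row k0 B = _); last by apply/rowP => j; rewrite !mxE.
  by rewrite -row_mul mulmxV // row1.
pose P : set {mpoly K[d]} := [set p | reciprocal_map l p = 0].
have prP : is_prime_ideal P by apply: ker_prime_ideal.
apply: (@height_add_trdeg_le K d k n P [tuple 'X_(f k) | k < n]).
  apply: codim => //; apply: ideal_gen_prime => // g [+ _].
  apply: ideal_gen_prime => // _ [S [c [_ _ rel ->]]].
  apply: reciprocal_ot_generator => //.
  under eq_bigr do rewrite rowlE scalemxAl.
  by rewrite -mulmx_suml rel mul0mx.
move=> F PF; apply: inverse_vars_free; rewrite -[RHS]PF comp_mpolyEX raddf_sum /=.
rewrite /mmap; apply: eq_bigr => m _; rewrite -/(mmap _ _ _).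
rewrite mmapZ comp_mpolyX rmorph_prod /mmap1; congr (_ * _); apply: eq_bigr => j _.
by rewrite rmorphXn /= tnth_mktuple mmapX mmap1U lf linform_delta.
Qed.

End Reciprocals.

Local Close Scope classical_set_scope.

(** * The grading of the exterior algebra *)

Section ExteriorGrading.
Variables (K : fieldType) (d : nat).
Local Notation E := (exterior K d).
Implicit Types (u v : E) (S T : {set 'I_d}).

Lemma ext_mulE u v T : (u * v) T =
  \sum_(S : {set 'I_d} | S \subset T) ext_sign K S (T :\: S) * (u S * v (T :\: S)).
Proof. by rewrite ffunE. Qed.

Definition exthomog (k : nat) u := forall T, #|T| != k -> u T = 0.

Lemma exthomogM (j k : nat) u v : exthomog j u -> exthomog k v -> exthomog (j + k) (u * v).
Proof.
move=> hu hv T Tjk; rewrite ext_mulE big1 // => S sST.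
have [Sj|/hu->] := eqVneq #|S| j; last by rewrite mul0r mulr0.
have [Tk|/hv->] := eqVneq #|T :\: S| k; last by rewrite !mulr0.
by rewrite -(cardsID S T) (setIidPr sST) Sj Tk eqxx in Tjk.
Qed.

Lemma exthomog_basis S : exthomog #|S| (ext_basis K S).
Proof. by move=> T; rewrite ffunE; have [->|] := eqVneq T S; rewrite ?eqxx. Qed.

Lemma exthomog_prod (s : seq 'I_d) : exthomog (size s) (\prod_(i <- s) ext_gen K i).
Proof.
elim: s => [|i s IHs]; first by rewrite big_nil /= -(cards0 'I_d); apply: exthomog_basis.
rewrite big_cons -[size _]/(1 + size s)%N; apply: exthomogM => //.
by rewrite -(cards1 i); apply: exthomog_basis.
Qed.

Lemma ext_expand u : u = \sum_T u T *: ext_basis K T.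
Proof.
apply/ffunP => S; rewrite sum_ffunE (bigD1 S) //= big1 => [|T /negPf nTS].
  by rewrite !ffunE eqxx addr0 /GRing.scale /= mulr1.
by rewrite !ffunE eq_sym nTS /GRing.scale /= mulr0.
Qed.

Definition ext_deg_basis k :=
  [tuple ext_basis K (enum_val i) | i < #|[set T : {set 'I_d} | #|T| == k]|].

Lemma ext_deg_basis_free k : free (ext_deg_basis k).
Proof.
apply/freeP => c c0 i.
have := congr1 (fun u : E => u (enum_val i)) c0; rewrite sum_ffunE [RHS]ffunE => <-.
rewrite (bigD1 i) //= big1 => [|j /negPf nji].
  by rewrite (nth_map i) ?size_enum_ord // nth_ord_enum !ffunE eqxx addr0 /GRing.scale /= mulr1.
rewrite (nth_map i) ?size_enum_ord // nth_ord_enum !ffunE (inj_eq enum_val_inj).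
by rewrite eq_sym nji /GRing.scale /= mulr0.
Qed.

Lemma mem_ext_deg_basis k u : reflect (exthomog k u) (u \in <<ext_deg_basis k>>%VS).
Proof.
apply: (iffP idP) => [/coord_span-> T Tk|hu].
  rewrite sum_ffunE big1 // => i _.
  rewrite (nth_map i) ?size_enum_ord // nth_ord_enum !ffunE.
  have /negPf-> : T != enum_val i.
    by apply: contraNneq Tk => ->; have := enum_valP i; rewrite inE.
  by rewrite /GRing.scale /= mulr0.
rewrite (ext_expand u); apply: memv_suml => T _.
have [Tk|/hu->] := eqVneq #|T| k; last by rewrite scale0r mem0v.
apply/memvZ/memv_span/mapP.
have TA : T \in [set T : {set 'I_d} | #|T| == k] by rewrite inE Tk.
by exists (enum_rank_in TA T); rewrite ?mem_enum // enum_rankK_in.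
Qed.

Lemma ext_deg_span k : ext_deg K d k = <<ext_deg_basis k>>%VS.
Proof.
apply/eqP; rewrite eqEsubv; apply/andP; split.
  elim: k => [|k IHk].
    apply/subvP => _ /vlineP[c ->]; apply/mem_ext_deg_basis => T T0.
    by rewrite ffunE (exthomog_basis (S := set0)) ?cards0 // /GRing.scale /= mulr0.
  rewrite /ext_deg expvSl; apply/prodvP => u v ug /(subvP IHk) /mem_ext_deg_basis hv.
  apply/mem_ext_deg_basis; rewrite -[k.+1]add1n; apply: exthomogM => //.
  apply/mem_ext_deg_basis; move: u ug; apply/subvP/span_subvP => _ /mapP[i _ ->].
  by apply/mem_ext_deg_basis; rewrite -(cards1 i); apply: exthomog_basis.
apply/span_subvP => _ /mapP[i _ ->]; have := enum_valP i; rewrite inE => /eqP.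
move: (enum_val i) => S Sk; rewrite ext_basisE -Sk cardE.
elim: (enum S) => [|j s IHs]; first by rewrite big_nil; apply: memv_line.
rewrite big_cons /ext_deg expvSl; apply: memv_mul => //.
by apply: memv_span; apply: map_f; rewrite mem_enum.
Qed.

Lemma mem_ext_deg k u : reflect (exthomog k u) (u \in ext_deg K d k).
Proof. by rewrite ext_deg_span; apply: mem_ext_deg_basis. Qed.

Lemma dim_ext_deg k : \dim (ext_deg K d k) = 'C(d, k).
Proof.
rewrite ext_deg_span; have /eqP-> := ext_deg_basis_free k.
rewrite size_tuple -[in RHS](card_ord d) -cardsT -cards_draws.
by apply: eq_card => S; rewrite !inE subsetT.
Qed.

(** If v has no component of degree below r, then up to degree r only the
    scalar part of u contributes to u v; [ext_mul_lowr] is the mirror image. *)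
Lemma ext_mul_lowl u v r T : (forall S, (#|S| < r)%N -> v S = 0) ->
  (#|T| <= r)%N -> (u * v) T = u set0 * v T.
Proof.
move=> v0 Tr; rewrite ext_mulE (bigD1 set0) ?sub0set //= big1.
  by rewrite setD0 ext_sign0l mul1r addr0.
move=> S /andP[sST S0]; rewrite v0 ?mulr0 //; apply: leq_trans Tr.
apply: proper_card; rewrite properE subsetDl; apply/negP => sT.
case/set0Pn: S0 => i iS; have := subsetP sT i (subsetP sST i iS).
by rewrite inE iS.
Qed.

Lemma ext_mul_lowr u v r T : (forall S, (#|S| < r)%N -> u S = 0) ->
  (#|T| <= r)%N -> (u * v) T = u T * v set0.
Proof.
move=> u0 Tr; rewrite ext_mulE (bigD1 T) //= big1.
  by rewrite setDv ext_sign0r mul1r addr0.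
move=> S /andP[sST ST]; rewrite u0 ?mul0r ?mulr0 //; apply: leq_trans Tr.
by apply: proper_card; rewrite properEneq ST.
Qed.

Definition ext_proj (k : nat) u : E :=
  [ffun T : {set 'I_d} => if #|T| == k then u T else 0].

Lemma ext_proj_is_linear k : linear (ext_proj k).
Proof.
move=> c u v; apply/ffunP => T; rewrite !ffunE.
by case: ifP => _ //; rewrite /GRing.scale /= mulr0 addr0.
Qed.
HB.instance Definition _ k :=
  GRing.isLinear.Build K E E _ (ext_proj k) (ext_proj_is_linear k).

End ExteriorGrading.

Lemma exthomog_boundary (K : fieldType) (d : nat) (s : seq 'I_d) :
  exthomog (size s).-1 (os_boundary K s).
Proof.
move=> T sT; rewrite /os_boundary sum_ffunE big1 // => q _; rewrite ffunE.
rewrite (@exthomog_prod K d (take q s ++ drop q.+1 s)) ?scaler0 //.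
apply: contraNneq sT => ->; rewrite size_cat size_take size_drop ltn_ord.
by have := ltn_ord q; lia.
Qed.

(** * The Orlik-Solomon ideal in degree two *)

Section OrlikSolomonDegreeTwo.
Variables (K : fieldType) (d n : nat) (alpha : 'M[K]_(d, n)).
Local Notation dependent S := (codim_flat alpha S < #|S|)%N.

Definition triple_relations : {vspace exterior K d} :=
  (\sum_(S : {set 'I_d} | dependent S && (#|S| == 3)) <[os_boundary K (enum S)]>)%VS.

Lemma triple_relations_deg : (triple_relations <= ext_deg K d 2)%VS.
Proof.
apply/subv_sumP => S /andP[_ /eqP S3]; rewrite -memvE; apply/mem_ext_deg.
by have := @exthomog_boundary K d (enum S); rewrite -cardE S3.
Qed.

Lemma triple_relations_sub_os_ideal : (triple_relations <= os_ideal alpha)%VS.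
Proof.
apply/subv_sumP => S /andP[depS _].
rewrite -memvE -[os_boundary _ _]mulr1 -[os_boundary _ _]mul1r.
apply: memv_mul; last exact: memvf.
apply: memv_mul; first exact: memvf.
by apply: (subvP (sumv_sup S depS (subvv _))); apply: memv_line.
Qed.

(** The elements without component of degree below two whose quadratic part
    lies in the span of the triple relations form a two-sided ideal U: passing
    to the quadratic part of a product with a only multiplies by the scalar
    part of a.  Boundaries of dependent sets with more than three elements have
    degree at least three, so all the generators are in U. *)
Lemma os_ideal_deg2 : (forall S, dependent S -> (3 <= #|S|)%N) ->
  (ext_deg K d 2 :&: os_ideal alpha)%VS = triple_relations.
Proof.
move=> dep3; apply/eqP; rewrite eqEsubv andbC subv_cap.
rewrite triple_relations_deg triple_relations_sub_os_ideal /=.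
pose pr k := linfun (@ext_proj K d k).
pose U := (lker (pr 0%N) :&: lker (pr 1%N) :&: (pr 2%N @^-1: triple_relations))%VS.
have UP (u : exterior K d) : reflect
    ((forall T : {set 'I_d}, (#|T| < 2)%N -> u T = 0) /\
     ext_proj 2 u \in triple_relations)
    (u \in U).
  rewrite !memv_cap !memv_ker -memv_preim !lfunE /=.
  apply: (iffP idP) => [/andP[/andP[/eqP u0 /eqP u1] u2]|[ulow u2]].
    split=> // T; case eT: #|T| => [|[|//]] _.
      by have /ffunP/(_ T) := u0; rewrite !ffunE eT.
    by have /ffunP/(_ T) := u1; rewrite !ffunE eT.
  rewrite u2 andbT; apply/andP; split; apply/eqP/ffunP => T; rewrite !ffunE;
    by case: eqP => // eT; rewrite ulow // eT.
have Ul (a u : exterior K d) : u \in U -> a * u \in U.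
  case/UP=> ulow u2; apply/UP; split=> [T T2|].
    by rewrite (ext_mul_lowl _ ulow) ?(ltnW T2) // ulow // mulr0.
  rewrite (_ : @ext_proj K d 2 _ = (a set0 : K) *: ext_proj 2 u) ?memvZ //.
  apply/ffunP => T; rewrite [LHS]ffunE [RHS]ffunE [in RHS]ffunE.
  case: eqP => eT; rewrite /GRing.scale /= ?mulr0 //.
  by rewrite (ext_mul_lowl _ ulow) ?eT.
have Ur (a u : exterior K d) : u \in U -> u * a \in U.
  case/UP=> ulow u2; apply/UP; split=> [T T2|].
    by rewrite (ext_mul_lowr _ ulow) ?(ltnW T2) // ulow // mul0r.
  rewrite (_ : @ext_proj K d 2 _ = (a set0 : K) *: ext_proj 2 u) ?memvZ //.
  apply/ffunP => T; rewrite [LHS]ffunE [RHS]ffunE [in RHS]ffunE.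
  case: eqP => eT; rewrite /GRing.scale /= ?mulr0 //.
  by rewrite (ext_mul_lowr _ ulow) ?eT // mulrC.
have sIU : (os_ideal alpha <= U)%VS.
  apply/prodvP => u a uEB _; apply: Ur; move: u uEB.
  apply/subvP/prodvP => b u _ uB; apply: Ul; move: u uB.
  apply/subvP/subv_sumP => S depS; rewrite -memvE; apply/UP.
  have := @exthomog_boundary K d (enum S); rewrite -cardE.
  have := dep3 S depS; rewrite leq_eqVlt => /orP[/eqP eS|S4] hom.
    have hom2 : exthomog 2 (os_boundary K (enum S)) by move: hom; rewrite -eS.
    split=> [T T2|]; first by rewrite hom2 // neq_ltn T2.
    rewrite (_ : @ext_proj K d 2 _ = os_boundary K (enum S)).
      have depS3 : dependent S && (#|S| == 3) by rewrite depS -eS.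
      by apply: (subvP (sumv_sup S depS3 (subvv _))); apply: memv_line.
    by apply/ffunP => T; rewrite ffunE; case: eqP => // /eqP/hom2.
  have low (T : {set 'I_d}) : (#|T| <= 2)%N -> os_boundary K (enum S) T = 0.
    by move=> T2; apply: hom; move: S4 T2; case: #|S| => [|s] /=; lia.
  split=> [T /ltnW/low //|].
  rewrite (_ : @ext_proj K d 2 _ = 0) ?mem0v //; apply/ffunP => T; rewrite !ffunE.
  by case: eqP => // eT; rewrite low ?eT.
apply/subvP => u /memv_capP[/mem_ext_deg hu /(subvP sIU)/UP[_]].
rewrite (_ : @ext_proj K d 2 u = u) //; apply/ffunP => T; rewrite ffunE.
by case: eqP => // /eqP/hu.
Qed.

End OrlikSolomonDegreeTwo.

(** * Dependent sets and linear relations *)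

Section Dependence.
Variables (K : fieldType) (d n : nat) (alpha : 'M[K]_(d, n)).
Implicit Types S : {set 'I_d}.
Local Notation dependent S := (codim_flat alpha S < #|S|)%N.

Lemma codim_flatE S :
  codim_flat alpha S = \rank (rowsub (@enum_val _ (mem S)) alpha).
Proof.
set A := rowsub _ _.
have rkflat : \rank (flat alpha S) = \rank (kermx A^T).
  suff: (flat alpha S :=: kermx A^T)%MS by move=> /eqmxP/eqmx_rank.
  apply/eqmxP/andP; split; apply/rV_subP => u.
    move/sub_bigcapmxP=> uS; apply/sub_kermxP/rowP => j.
    have /uS/sub_kermxP/rowP/(_ 0) := enum_valP j.
    rewrite !mxE => h; rewrite -[RHS]h; apply: eq_bigr => i _; by rewrite !mxE.
  move/sub_kermxP/rowP=> uA; apply/sub_bigcapmxP => i iS; apply/sub_kermxP/rowP => j.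
  have := uA (enum_rank_in iS i); rewrite !mxE => h; rewrite -[RHS]h; apply: eq_bigr => x _.
  by rewrite !mxE enum_rankK_in // ord1.
by rewrite /codim_flat rkflat mxrank_ker mxrank_tr subKn // rank_leq_col.
Qed.

Lemma dependentP S :
  dependent S <-> exists2 c : 'I_d -> K,
    (exists2 j, j \in S & c j != 0) & \sum_(j in S) c j *: row j alpha = 0.
Proof.
rewrite codim_flatE; set A := rowsub _ _.
have sumE (c : 'I_d -> K) :
    \sum_(j in S) c j *: row j alpha = (\row_i c (enum_val i)) *m A.
  rewrite mulmx_sum_row big_enum_val /=; apply: eq_bigr => i _.
  by rewrite mxE row_rowsub.
have -> : (\rank A < #|S|)%N = (kermx A != 0).
  by rewrite kermx_eq0 /row_free ltn_neqAle rank_leq_row andbT.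
split=> [/rowV0Pn[v /sub_kermxP vA v0]|[c [j jS cj] rel]].
  (* The extension of v by zero outside S. *)
  pose c j := \sum_(i | enum_val i == j) v 0 i.
  have cE i : c (enum_val i) = v 0 i.
    rewrite /c (big_pred1 i) // => k /=; exact: (inj_eq enum_val_inj).
  exists c.
    by case/rV0Pn: v0 => i vi; exists (enum_val i); rewrite ?enum_valP ?cE.
  by rewrite sumE -[RHS]vA; congr (_ *m _); apply/rowP => i; rewrite mxE cE.
apply/rowV0Pn; exists (\row_i c (enum_val i)); first by apply/sub_kermxP; rewrite -sumE.
by apply/rV0Pn; exists (enum_rank_in jS j); rewrite mxE enum_rankK_in.
Qed.

End Dependence.

Lemma enum_set3 d (S : {set 'I_d}) : #|S| = 3 ->
  exists i j k : 'I_d, [/\ (i < j)%N, (j < k)%N, enum S = [:: i; j; k] & S = [set i; j; k]].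
Proof.
move=> S3; have : sorted (fun i j : 'I_d => i < j)%N (enum S).
  rewrite /enum_mem; apply: sorted_filter => [i j k|]; first exact: ltn_trans.
  by rewrite -enumT -[sorted _ _](@sorted_map _ _ val ltn) val_enum_ord iota_ltn_sorted.
have := cardE S; rewrite S3; case eS: (enum S) => [|i [|j [|k [|//]]]] // _ /= /and3P[ij jk _].
exists i, j, k; split=> //; apply/setP => x; rewrite -mem_enum eS !inE.
by rewrite orbA.
Qed.

Lemma big_set3 (V : Type) (idx : V) (op : Monoid.com_law idx) d (i j k : 'I_d)
    (F : 'I_d -> V) : (i < j)%N -> (j < k)%N ->
  \big[op/idx]_(x in [set i; j; k]) F x = op (F i) (op (F j) (F k)).
Proof.
move=> ij jk; have neq (x y : 'I_d) : (x < y)%N -> x != y.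
  by apply: contraTneq => ->; rewrite ltnn.
rewrite -setUA big_setU1; last by rewrite !inE negb_or !neq // (ltn_trans ij).
by rewrite big_setU1 ?inE ?neq //= big_set1.
Qed.

Lemma set2_lt_inj d (i j a b : 'I_d) : (i < j)%N -> (a < b)%N ->
  [set i; j] = [set a; b] -> i = a /\ j = b.
Proof.
move=> ij ab e.
have := set21 i j; have := set22 i j; rewrite e.
have := set21 a b; have := set22 a b; rewrite -e !inE -!val_eqE /= => h1 h2 h3 h4.
by split; apply: val_inj => /=; lia.
Qed.

(** * Coordinates indexed by pairs *)

Section PairMap.
Variables (K : fieldType) (d : nat) (V : vectType K) (F : 'I_d -> 'I_d -> V).

(** Maps of this form serve both to compare exterior and symmetric squares and
    to send a triple relation to the linear relation behind it; they only see
    the component of degree two of u. *)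
Definition pair_map (u : exterior K d) : V :=
  \sum_(i < d) \sum_(j < d | (i < j)%N) (u [set i; j] : K) *: F i j.

Lemma pair_map_is_linear : linear pair_map.
Proof.
move=> c u v; rewrite /pair_map scaler_sumr -big_split /=; apply: eq_bigr => i _.
rewrite scaler_sumr -big_split /=; apply: eq_bigr => j _.
by rewrite !ffunE scalerDl -scalerA.
Qed.
HB.instance Definition _ := GRing.isLinear.Build K _ _ _ pair_map pair_map_is_linear.

Lemma pair_map_basis (a b : 'I_d) : (a < b)%N -> pair_map (ext_basis K [set a; b]) = F a b.
Proof.
move=> ab; rewrite /pair_map.
have Fij (i j : 'I_d) : (i < j)%N -> (i != a) || (j != b) ->
    (ext_basis K [set a; b] [set i; j] : K) *: F i j = 0.
  move=> ij nab; rewrite ffunE; case: eqP => [/set2_lt_inj[] // ia jb|_].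
    by rewrite ia jb !eqxx in nab.
  by rewrite scale0r.
rewrite (bigD1 a) //= (bigD1 b) //= ffunE eqxx scale1r !big1 ?addr0 //.
  by move=> i ia; rewrite big1 // => j ij; rewrite Fij // ia.
by move=> j /andP[aj jb]; rewrite Fij // jb orbT.
Qed.

End PairMap.

Lemma ext_gen_mul_lt (K : fieldType) d (i j : 'I_d) : (i < j)%N ->
  ext_gen K i * ext_gen K j = ext_basis K [set i; j].
Proof.
move=> ij; rewrite ext_basisM disjoints1 inE -val_eqE /= ltn_eqF //=.
by rewrite /ext_sign !big_set1 ltnNge ltnW //= expr0 scale1r.
Qed.

Lemma os_boundary3 (K : fieldType) d (i j k : 'I_d) : (i < j)%N -> (j < k)%N ->
  os_boundary K [:: i; j; k] =
    ext_basis K [set j; k] - ext_basis K [set i; k] + ext_basis K [set i; j].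
Proof.
move=> ij jk; rewrite /os_boundary !big_ord_recl big_ord0 /= /bump /=.
rewrite !big_cons !big_nil !mulr1 !ext_gen_mul_lt // ?(ltn_trans ij) //.
by rewrite expr0 scale1r expr1 scaleN1r sqrrN expr1n scale1r addr0 addrA.
Qed.

(** * Quadratic coefficients of polynomials *)

Section QuadraticCoefficients.
Variables (K : fieldType) (d : nat).
Implicit Types (p q : {mpoly K[d]}) (m : 'X_{1..d}).

Lemma mcoeffM_lowest p q m :
  (forall m', (mdeg m' < mdeg m)%N -> q@_m' = 0) -> (p * q)@_m = p@_0 * q@_m.
Proof.
move=> qlow; rewrite mcoeffM.
have lt0 : (mdeg (0%MM : 'X_{1..d}) < (mdeg m).+1)%N by rewrite mdeg0.
rewrite (bigD1 (BMultinom lt0, BMultinom (ltnSn (mdeg m)))) /=; last by rewrite add0m.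
rewrite big1 ?addr0 // => -[k1 k2] /= /andP[/eqP em ne].
have md : (mdeg k1 + mdeg k2 = mdeg m)%N.
  by rewrite -mdegD; apply/congr1/esym.
rewrite qlow ?mulr0 //; apply: (@leq_trans (mdeg k1 + mdeg k2)); last by rewrite md.
rewrite -[ltnLHS]add0n ltn_add2r lt0n mdeg_eq0.
apply: contraNneq ne => k10; have k2m : k2 = m :> 'X_{1..d}.
  by apply/esym; apply: etrans em _; rewrite k10 add0m.
by rewrite xpair_eqE -!val_eqE /= k10 k2m !eqxx.
Qed.

(** Only the squarefree quadratic monomials y_i y_j are recorded, each one once:
    they correspond to the basis e_i e_j of the exterior square, and no other
    monomial occurs in the quadratic generators of the Orlik-Terao ideal. *)
Definition quad_coeffs p : 'M[K]_d :=
  \matrix_(i, j) if (i < j)%N then p@_(U_(i) + U_(j)) else 0.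

Lemma quad_coeffs_is_linear : linear quad_coeffs.
Proof.
move=> c p q; apply/matrixP => i j; rewrite !mxE; case: ifP => _.
  by rewrite mcoeffD mcoeffZ.
by rewrite mulr0 addr0.
Qed.
HB.instance Definition _ :=
  GRing.isLinear.Build K _ _ _ quad_coeffs quad_coeffs_is_linear.

Lemma quad_coeffs_XX (a b : 'I_d) : (a < b)%N -> quad_coeffs ('X_a * 'X_b) = delta_mx a b.
Proof.
move=> ab; apply/matrixP => i j; rewrite !mxE -mpolyXD mcoeffX.
case: ifP => ij.
  rewrite (_ : (_ == _)%MM = (i == a) && (j == b)) //.
  apply/eqP/andP => [/mnmP e|[/eqP-> /eqP->]] //.
  have := e a; have := e b; rewrite !mnmDE !mnm1E !eqxx -!val_eqE /=.
  by move: ab ij; case: eqP; case: eqP; case: eqP; case: eqP; case: eqP; case: eqP; lia.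
have [ia|//] := eqVneq i a; have [jb|//] := eqVneq j b.
by rewrite ia jb ab in ij.
Qed.

Lemma ot_generator3 (i j k : 'I_d) (c : 'I_d -> K) : (i < j)%N -> (j < k)%N ->
  ot_generator [set i; j; k] c =
    c i *: ('X_j * 'X_k) + c j *: ('X_i * 'X_k) + c k *: ('X_i * 'X_j).
Proof.
move=> ij jk; rewrite /ot_generator; under eq_bigr do rewrite big_mkcondr.
have neq (x y : 'I_d) : (x < y)%N -> (x != y) * (y != x).
  by move=> xy; rewrite [y == x]eq_sym; split; apply: contraTneq xy => ->; rewrite ltnn.
have [nij njk] := (neq _ _ ij, neq _ _ jk); have nik := neq _ _ (ltn_trans ij jk).
by rewrite !big_set3 //= !eqxx !nij !njk !nik /= !mulr1 !mul1r addrA.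
Qed.

(** The quadratic part of a g, for g without terms of degree below two, is that
    of g times the constant term of a.  So the quadratic parts of an ideal
    generated by such polynomials are spanned by those of its generators. *)
Lemma quad_coeffs_ideal N (g : 'I_N -> {mpoly K[d]}) p :
  (forall k m, (mdeg m < 2)%N -> (g k)@_m = 0) ->
  ideal_gen (range g) p -> quad_coeffs p \in <<[seq quad_coeffs (g k) | k : 'I_N]>>%VS.
Proof.
move=> glow [r [a [h [gh ->]]]]; rewrite linear_sum /=; apply: memv_suml => i _.
have [k _ <-] := gh i.
rewrite (_ : quad_coeffs _ = (a i)@_0 *: quad_coeffs (g k)); last first.
  apply/matrixP => x y; rewrite !mxE; case: ifP => _; last by rewrite mulr0.
  by rewrite mcoeffM_lowest // mdegD !mdeg1; apply: glow.
by apply/memvZ/memv_span/map_f; rewrite mem_enum.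
Qed.

End QuadraticCoefficients.

(** * Comparing relations in a generic plane *)

Section GenericPlane.
Variables (K : fieldType) (d n : nat) (alpha : 'M[K]_(d, n)) (v v' : 'cV[K]_n).
Local Notation dependent S := (codim_flat alpha S < #|S|)%N.
Let a j := (alpha *m v) j 0.
Let b j := (alpha *m v') j 0.
Let w i j := a i * b j - a j * b i.
Hypothesis a_neq0 : forall j, a j != 0.
Hypothesis w_neq0 : forall i j, i != j -> w i j != 0.

Lemma relation_eval (S : {set 'I_d}) (c : 'I_d -> K) (x : 'cV_n) :
  \sum_(j in S) c j *: row j alpha = 0 -> \sum_(j in S) c j * (alpha *m x) j 0 = 0.
Proof.
move=> rel; transitivity (((\sum_(j in S) c j *: row j alpha) *m x) 0 0).
  rewrite mulmx_suml summxE; apply: eq_bigr => j _.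
  by rewrite -scalemxAl -row_mul !mxE.
by rewrite rel mul0mx mxE.
Qed.

(** For i <> k the vectors (a_i, b_i) and (a_k, b_k) are independent, as their
    determinant w i k is nonzero; a relation on a single form is excluded by
    a_i <> 0. *)
Lemma dependent_card_ge3 (S : {set 'I_d}) : dependent S -> (3 <= #|S|)%N.
Proof.
case/dependentP=> c [j jS cj] rel; rewrite ltnNge; apply/negP.
have := relation_eval v' rel; have := relation_eval v rel => {rel}.
rewrite -/a -/b leq_eqVlt => ra rb /orP[/cards2P[i [k [ik eS]]]|].
  have wki : w k i != 0 by rewrite w_neq0 // eq_sym.
  move: ra rb; rewrite eS !big_setU1 ?inE //= !big_set1 => ra rb.
  have : c i * w i k = 0.
    rewrite (_ : c i * _ = b k * (c i * a i + c k * a k) - a k * (c i * b i + c k * b k));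
      by [rewrite ra rb !mulr0 subr0|rewrite /w; ring].
  have : c k * w k i = 0.
    rewrite (_ : c k * _ = b i * (c i * a i + c k * a k) - a i * (c i * b i + c k * b k));
      by [rewrite ra rb !mulr0 subr0|rewrite /w; ring].
  move=> /eqP; rewrite mulf_eq0 (negPf wki) orbF => /eqP ck.
  move=> /eqP; rewrite mulf_eq0 (negPf (w_neq0 ik)) orbF => /eqP ci.
  by move: jS cj; rewrite eS !inE => /orP[] /eqP->; rewrite ?ci ?ck eqxx.
rewrite ltnS => S1; have eS : S = [set j].
  by apply/esym/eqP; rewrite eqEcard sub1set jS cards1.
by move: ra; rewrite eS big_set1 => /eqP; rewrite mulf_eq0 (negPf cj) (negPf (a_neq0 j)).
Qed.

(** Cramer's rule for the two equations sum c_x a_x = sum c_x b_x = 0. *)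
Lemma triple_relation (i j k : 'I_d) (c : 'I_d -> K) : (i < j)%N -> (j < k)%N ->
  \sum_(x in [set i; j; k]) c x *: row x alpha = 0 ->
  [/\ c i * w i j = c k * w j k & c j * w i j = - (c k * w i k)].
Proof.
move=> ij jk rel; have := relation_eval v' rel; have := relation_eval v rel.
rewrite !big_set3 //= !addrA -/(a _) -/(b _) => ra rb.
split; apply/eqP; rewrite -subr_eq0; apply/eqP.
  transitivity (b j * (c i * a i + c j * a j + c k * a k)
    - a j * (c i * b i + c j * b j + c k * b k)); last by rewrite ra rb !mulr0 subr0.
  by rewrite /w; ring.
transitivity (a i * (c i * b i + c j * b j + c k * b k)
  - b i * (c i * a i + c j * a j + c k * a k)); last by rewrite ra rb !mulr0 subr0.
by rewrite /w; ring.
Qed.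

Lemma ot_quadratic_ideal_low f (m : 'X_{1..d}) :
  ot_quadratic_ideal alpha f -> (mdeg m < 2)%N -> f@_m = 0.
Proof.
move=> [r [p [g [Jg ->]]]] m2; rewrite raddf_sum big1 //= => i _.
have [_ hom] := Jg i.
have low m' : (mdeg m' < 2)%N -> (g i)@_m' = 0.
  by move=> m'2; apply: dhomog_nemf_coeff hom _; rewrite neq_ltn m'2.
by rewrite mcoeffM_lowest ?low ?mulr0 // => m' lt; apply/low/(ltn_trans lt).
Qed.

(** In the squarefree quadratic coordinates of [quad_coeffs], this is the map
    e_i e_j |-> w_ij y_i y_j. *)
Let Psi := linfun (pair_map (fun i j : 'I_d => w i j *: delta_mx i j : 'M[K]_d)).

(** The cross product of (a_i, a_j, a_k) and (b_i, b_j, b_k) spans the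
    orthogonal complement of these two vectors, so a relation on a dependent
    triple can only be a nonzero multiple of it. *)
Lemma triple_scaled (i j k : 'I_d) (c : 'I_d -> K) :
  (i < j)%N -> (j < k)%N -> (exists2 x, x \in [set i; j; k] & c x != 0) ->
  \sum_(x in [set i; j; k]) c x *: row x alpha = 0 ->
  exists2 z : K, z != 0 & [/\ c i = z * w j k, c j = - (z * w i k) & c k = z * w i j].
Proof.
move=> ij jk nz rel; have [ci cj] := triple_relation ij jk rel.
have nij : i != j by apply: contraTneq ij => ->; rewrite ltnn.
have wij := w_neq0 nij; exists (c k / w i j); last first.
  by split; [rewrite mulrAC -ci|rewrite mulrAC -mulNr -cj|]; rewrite ?mulfVK ?mulfK.
rewrite mulf_neq0 ?invr_neq0 //; apply/eqP => ck.
have {}ci : c i = 0 by apply: (mulIf wij); rewrite ci ck !mul0r.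
have {}cj : c j = 0 by apply: (mulIf wij); rewrite cj ck !mul0r oppr0.
by case: nz => x; rewrite !inE => /orP[/orP[]|] /eqP->; rewrite ?ci ?cj ?ck eqxx.
Qed.

(** The rescaling e_i e_j |-> w_ij y_i y_j is injective in degree two, since no
    w_ij vanishes, and takes the boundary of a dependent triple to
    w_jk y_j y_k - w_ik y_i y_k + w_ij y_i y_j, which is proportional to the
    Orlik-Terao generator of that triple by [triple_scaled]. *)
Lemma triple_relations_dim_le N :
  generated_by_n (ot_quadratic_ideal alpha) N -> (\dim (triple_relations alpha) <= N)%N.
Proof.
move=> [g eJ].
have Jg k : ot_quadratic_ideal alpha (g k) by rewrite eJ; apply: ideal_gen_mem; exists k.
have glow k m : (mdeg m < 2)%N -> (g k)@_m = 0 by apply: ot_quadratic_ideal_low.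
set L := [seq quad_coeffs (g k) | k : 'I_N].
have sWL : (triple_relations alpha <= Psi @^-1: <<L>>)%VS.
  apply/subv_sumP => S /andP[depS /eqP S3]; rewrite -memvE -memv_preim lfunE /=.
  have [i [j [k [ij jk eS defS]]]] := enum_set3 S3; have ik := ltn_trans ij jk.
  have [c nz rel] := (dependentP _ _).1 depS; move: nz rel; rewrite defS => nz rel.
  have [z z0 [ci cj ck]] := triple_scaled ij jk nz rel.
  have Jf : ot_quadratic_ideal alpha (ot_generator S c).
    apply: ideal_gen_mem; split.
      by apply: ideal_gen_mem; exists S, c; split; rewrite // defS.
    rewrite defS ot_generator3 // -!mpolyXD.
    by rewrite !dhomogD ?dhomogZ ?dhomogX //= !mdegD !mdeg1.
  have := quad_coeffs_ideal glow; rewrite -eJ => /(_ _ Jf).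
  rewrite defS ot_generator3 // !linearD !linearZ /= !quad_coeffs_XX //.
  rewrite -defS eS os_boundary3 // linearD linearB /= !pair_map_basis //.
  move=> h; rewrite (_ : w j k *: _ - _ + _ = z^-1 *:
    (c i *: delta_mx j k + c j *: delta_mx i k + c k *: delta_mx i j));
    first exact: memvZ.
  apply/matrixP => x y; rewrite ci cj ck !mxE.
  by field.
have injPsi : (triple_relations alpha :&: lker Psi = 0)%VS.
  apply/eqP; rewrite -subv0; apply/subvP => u /memv_capP[uW]; rewrite memv_ker lfunE /= memv0.
  move/eqP=> Pu0; apply/eqP/ffunP => T; rewrite [RHS]ffunE.
  have [/eqP/cards2P[i0 [j0 [ne eT]]]|nT2] := eqVneq #|T| 2; last first.
    by move/mem_ext_deg: (subvP (triple_relations_deg alpha) u uW) => ->.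
  have [i [j [ij {}eT]]] : exists i j : 'I_d, (i < j)%N /\ T = [set i; j].
    move: ne; rewrite neq_ltn => /orP[lt|lt]; first by exists i0, j0.
    by exists j0, i0; split; rewrite // eT setUC.
  have := congr1 (fun M : 'M_d => M i j) Pu0; rewrite mxE /pair_map summxE.
  rewrite (bigD1 i) //= summxE (bigD1 j) //= !big1.
  - rewrite !addr0 !mxE !eqxx mulr1 eT => /eqP; rewrite mulf_eq0 (negPf (w_neq0 _)) ?orbF.
      by move/eqP.
    by rewrite neq_ltn ij.
  - move=> x xi; rewrite summxE big1 // => y _.
    by rewrite !mxE [i == x]eq_sym (negPf xi) !mulr0.
  - move=> y /andP[_ yj].
    by rewrite !mxE [j == y]eq_sym (negPf yj) andbF !mulr0.
rewrite -(limg_dim_eq injPsi).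
apply: (@leq_trans (\dim <<L>>)); last first.
  by rewrite (leq_trans (dim_span _)) // size_map -cardE card_ord.
apply: dimvS; apply/subvP => _ /memv_imgP[u uW ->]; rewrite memv_preim.
exact: (subvP sWL).
Qed.

(** The map T below is the gradient of the quadric w_ij y_i y_j at the point
    (1/a_i), with the l-th coordinate scaled by 1/a_l^2.  By construction it
    sends the boundary of i < j < k to
    - (w_jk, - w_ik, w_ij) / (a_i a_j a_k), a multiple of the relation on that
    triple.  Thus the image of the triple relations contains every relation
    with three nonzero coefficients, and these span by 2-formality. *)
Lemma le_dim_triple_relations :
  two_formal alpha -> (d <= \dim (triple_relations alpha) + n)%N.
Proof.
case=> r [B [eqB B3]].
pose F i j : 'rV[K]_d := (w i j / (a i * a j)) *:
   ((a i)^-1 *: delta_mx 0 i + (a j)^-1 *: delta_mx 0 j).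
pose T := linfun (pair_map F).
pose L : 'Hom('rV[K]_d, 'rV[K]_n) := linfun (mulmxr alpha).
have BT x : row x B \in (T @: triple_relations alpha)%VS.
  pose S := [set j | B x j != 0].
  have S3 : #|S| = 3 by rewrite cardsE B3.
  have rel : \sum_(j in S) B x j *: row j alpha = 0.
    have : row x B *m alpha = 0.
      by apply/sub_kermxP; rewrite (submx_trans (row_sub x B)) //; case/andP: eqB.
    rewrite mulmx_sum_row (bigID (mem S)) /= [X in _ + X]big1 => [|j].
      by rewrite addr0 => h; rewrite -[RHS]h; apply: eq_bigr => j _; rewrite mxE.
    by rewrite inE negbK mxE => /eqP->; rewrite scale0r.
  have [i [j [k [ij jk eS defS]]]] := enum_set3 S3; have ik := ltn_trans ij jk.
  have nz : exists2 y, y \in S & B x y != 0.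
    have iS : i \in S by rewrite defS !inE eqxx.
    by exists i => //; move: iS; rewrite inE.
  have depS : (codim_flat alpha S < #|S|)%N by apply/dependentP; exists (B x).
  have S0 y : y \notin S -> B x y = 0 by rewrite inE negbK => /eqP.
  rewrite defS in nz rel.
  have [z z0 [ci cj ck]] := triple_scaled ij jk nz rel.
  have Wb : os_boundary K (enum S) \in triple_relations alpha.
    have depS3 : (codim_flat alpha S < #|S|)%N && (#|S| == 3) by rewrite depS S3.
    by apply: (subvP (sumv_sup S depS3 (subvv _))); apply: memv_line.
  rewrite (_ : row x B = T (- (z * (a i * a j * a k)) *: os_boundary K (enum S)));
    first by rewrite memv_img // memvZ.
  rewrite lfunE linearZ /= eS os_boundary3 // linearD linearB /=.
  rewrite !pair_map_basis //.
  rewrite (row_sum_delta (row x B)) (bigID (mem [set i; j; k])) /=.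
  rewrite [X in _ + X]big1 ?addr0 => [|y yS]; last by rewrite mxE S0 ?scale0r // defS.
  rewrite big_set3 //= !mxE ci cj ck.
  apply/rowP => y; rewrite !mxE /w.
  by field; rewrite !a_neq0.
have kerT : (lker L <= T @: triple_relations alpha)%VS.
  apply/subvP => u; rewrite memv_ker lfunE /= => /eqP ua.
  have /submxP[y ->] : (u <= B)%MS.
    by case/andP: eqB => _; apply: submx_trans; apply/sub_kermxP.
  rewrite mulmx_sum_row; apply: memv_suml => x _; exact: memvZ.
have dimV k : \dim {:'rV[K]_k} = k by rewrite dimvf /dim /= mul1n.
have := limg_ker_dim L fullv; rewrite capfv dimV => dimL.
apply: (@leq_trans (\dim (lker L) + \dim (limg L))); first by rewrite dimL.
apply: leq_add; first apply: leq_trans (dimvS kerT) _.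
  by rewrite -(limg_ker_dim T) leq_addl.
by apply: leq_trans (dimvS (subvf _)) _; rewrite dimV.
Qed.

End GenericPlane.

(** * Existence of a generic plane *)

(** Points on the moment curve (1, t, t^2, ...) work: on it a nonzero linear
    form restricts to a nonzero polynomial in t, so all but finitely many t
    avoid all the hyperplanes at once. *)
Lemma avoid_hyperplanes (K : numFieldType) n (I : finType) (P : pred I) (r : I -> 'rV[K]_n) :
  (forall i, P i -> r i != 0) ->
  exists v : 'cV[K]_n, forall i, P i -> (r i *m v) 0 0 != 0.
Proof.
move=> r0; pose p i : {poly K} := \sum_k r i 0 k *: 'X^k.
have p0 : \prod_(i | P i) p i != 0.
  apply/prodf_neq0 => i Pi; case/rV0Pn: (r0 i Pi) => k rik.
  apply: contraNneq rik => /(congr1 (fun q : {poly K} => q`_k)); rewrite coef0 coef_sum.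
  rewrite (bigD1 k) //= coefZ coefXn eqxx mulr1 big1 ?addr0 => [->//|l /negPf lk].
  by rewrite coefZ coefXn eq_sym (inj_eq val_inj) lk mulr0.
have [t pt] : exists t, (\prod_(i | P i) p i).[t] != 0.
  pose s : seq K := [seq k%:R | k <- iota 0 (size (\prod_(i | P i) p i))].
  have [allr|/allPn[t _ pt]] := boolP (all (root (\prod_(i | P i) p i)) s); last by exists t.
  have us : uniq s by rewrite map_inj_uniq ?iota_uniq //; apply: mulrIn; rewrite oner_eq0.
  by have := max_poly_roots p0 allr us; rewrite size_map size_iota ltnn.
exists (\col_k t ^+ k) => i Pi; apply: contraNneq pt => ri.
rewrite horner_prod (bigD1 i) //= (_ : (p i).[t] = 0) ?mul0r // -[RHS]ri mxE horner_sum.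
by apply: eq_bigr => k _; rewrite mxE hornerZ hornerXn.
Qed.

Section Arrangement.
Variables (K : fieldType) (d n : nat) (alpha : 'M[K]_(d, n)).

Lemma central_not_proportional i j (x y : K) : central_arrangement alpha ->
  i != j -> x != 0 -> y != 0 -> x *: row i alpha != y *: row j alpha.
Proof.
move=> [_ inj] nij x0 y0; apply/eqP => e.
have sub i' j' (c c' : K) : c' != 0 -> c *: row i' alpha = c' *: row j' alpha ->
    (hyperplane alpha i' <= hyperplane alpha j')%MS.
  move=> c'0 {}e; apply/sub_kermxP.
  have : c' *: (hyperplane alpha i' *m (row j' alpha)^T) = 0.
    rewrite scalemxAr -linearZ /= -e linearZ /= -scalemxAr.
    by rewrite mulmx_ker scaler0.
  by move/eqP; rewrite scaler_eq0 (negPf c'0) => /eqP.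
case/eqP: nij; apply: inj; apply/andP; split.
  exact: sub y0 e.
exact: sub x0 (esym e).
Qed.

Lemma essential_row_full : essential alpha -> row_full alpha.
Proof.
move=> ess; rewrite /row_full -mxrank_tr -[_ == n]/(row_free alpha^T) -kermx_eq0.
apply/rowV0P => u /sub_kermxP uA.
apply/eqP; rewrite -submx0 -ess; apply/sub_bigcapmxP => i _; apply/sub_kermxP/rowP => j.
move/rowP/(_ i): uA; rewrite !mxE => h; rewrite -[RHS]h; apply: eq_bigr => k _.
by rewrite !mxE.
Qed.

End Arrangement.

(** After choosing v off the hyperplanes, the vector v' has to avoid the zeros
    of the forms a_i alpha_j - a_j alpha_i, which are nonzero because alpha_i
    and alpha_j are not proportional. *)
Lemma central_generic_plane (K : numFieldType) d n (alpha : 'M[K]_(d, n)) :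
  central_arrangement alpha -> exists v v' : 'cV[K]_n,
    (forall j, (alpha *m v) j 0 != 0) /\
    (forall i j, i != j -> (alpha *m v) i 0 * (alpha *m v') j 0 -
                           (alpha *m v) j 0 * (alpha *m v') i 0 != 0).
Proof.
move=> central; have [row0 _] := central.
have rowE i (x : 'cV_n) : (row i alpha *m x) 0 0 = (alpha *m x) i 0.
  by rewrite -row_mul mxE.
have [v va] := @avoid_hyperplanes K n 'I_d predT (fun i => row i alpha) (fun i _ => row0 i).
have {}va j : (alpha *m v) j 0 != 0 by rewrite -rowE va.
have [|v' wv] := @avoid_hyperplanes K n ('I_d * 'I_d)%type (fun ij => ij.1 != ij.2)
  (fun ij => (alpha *m v) ij.1 0 *: row ij.2 alpha - (alpha *m v) ij.2 0 *: row ij.1 alpha).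
  move=> [i j] /= nij; rewrite subr_eq0.
  by rewrite central_not_proportional // eq_sym.
exists v, v'; split=> // i j nij; have := wv (i, j) nij => /=.
by rewrite mulmxBl -!scalemxAl -!row_mul !mxE.
Qed.

(** * The second Betti number *)

Lemma os_betti2_of_generic_plane (K : fieldType) d n (alpha : 'M[K]_(d, n))
    (v v' : 'cV[K]_n) :
  (forall j, (alpha *m v) j 0 != 0) ->
  (forall i j, i != j -> (alpha *m v) i 0 * (alpha *m v') j 0 -
                         (alpha *m v) j 0 * (alpha *m v') i 0 != 0) ->
  central_arrangement alpha -> essential alpha -> two_formal alpha ->
  complete_intersection (ot_quadratic_ideal alpha) ->
  (os_betti alpha 2)%:Z = 'C(d, 2)%:Z - d%:Z + n%:Z.
Proof.
move=> a0 w0 [row0 _] ess formal [m [codim [gen _]]].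
have codim_le := orlik_terao_codim_le row0 (essential_row_full ess) codim.
have dim_le := triple_relations_dim_le w0 gen.
have dim_ge := le_dim_triple_relations a0 w0 formal.
have := dimvS (triple_relations_deg alpha).
rewrite /os_betti (os_ideal_deg2 (dependent_card_ge3 a0 w0)) dim_ext_deg.
move: (\dim _) dim_le dim_ge => q; lia.
Qed.

Theorem corollary1p8 (R : realType) (d n : nat) (alpha : 'M[R[i]]_(d, n)) :
  central_arrangement alpha ->
  essential alpha ->
  two_formal alpha ->
  complete_intersection (ot_quadratic_ideal alpha) ->
  ((os_betti alpha 2)%:Z = 'C(d, 2)%:Z - d%:Z + n%:Z)%R.
Proof.
move=> central; have [v [v' [a0 w0]]] := central_generic_plane central.
exact: os_betti2_of_generic_plane a0 w0 central.
Qed.
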